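(* Let $m\in\mathbb N$ and let $\nu$ be a Borel measure on $\mathrm{Mat}(\mathbb N,\mathbb C)$ belonging to the class $\mathfrak F(m;\mathrm{Mat}(\mathbb N,\mathbb C))$ and invariant under the action of $U(\infty)\times U(\infty)$. If $\nu$ is ergodic, then $\nu$ is finite, i.e. $\nu(\mathrm{Mat}(\mathbb N,\mathbb C))<+\infty$.
   Context: $\mathrm{Mat}(\mathbb N,\mathbb C)=\{z=(z_{ij})_{i,j\in\mathbb N}: z_{ij}\in\mathbb C\}$ is the space of all infinite complex matrices (with the topology of entrywise convergence and its Borel $\sigma$-algebra). $U(\infty)$ is the infinite unitary group: an infinite matrix $u=(u_{ij})_{i,j\in\mathbb N}$ belongs to $U(\infty)$ if there is $n_0\in\mathbb N$ such that $(u_{ij})_{1\le i,j\le n_0}$ is unitary, $u_{ii}=1$ for $i>n_0$, and $u_{ij}=0$ whenever $i\ne j$ and $\max(i,j)>n_0$. The group $U(\infty)\times U(\infty)$ acts on $\mathrm{Mat}(\mathbb N,\mathbb C)$ by $T_{(u_1,u_2)}z=u_1zu_2^{-1}$. Measures may be finite or infinite. A $U(\infty)\times U(\infty)$-invariant measure is ergodic if every $U(\infty)\times U(\infty)$-invariant Borel set either has measure zero or has complement of measure zero. For $m\in\mathbb N$, $\mathfrak F(m;\mathrm{Mat}(\mathbb N,\mathbb C))$ is the class of Borel measures $\nu$ on $\mathrm{Mat}(\mathbb N,\mathbb C)$ such that for every $R>0$ one has $\nu(\{z:\max_{i,j\le m}|z_{ij}|<R\})<+\infty$. *)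

(* Defs.v *)
From HB Require Import structures.
From mathcomp Require Import all_boot all_order all_algebra complex.
From mathcomp Require Import all_classical all_reals all_analysis.

Set Implicit Arguments.
Unset Strict Implicit.
Unset Printing Implicit Defensive.

Import Order.TTheory GRing.Theory Num.Theory.
Import numFieldNormedType.Exports.

Local Open Scope classical_set_scope.
Local Open Scope complex_scope.
Local Open Scope ring_scope.

(* R is an arbitrary realType and C is R[i]; R[i]^o is the copy of R[i] that
   carries the topology of the modulus.  Indices start at 0, so that
   "1 <= i <= n" reads "i < n". *)
Definition infmx (R : realType) := {ptws (nat * nat) -> R[i]^o}.

Definition borel_infmx (R : realType) :=
  g_sigma_algebraType (@open (infmx R)).

Section infinite_unitary_group.
Variable R : realType.
Implicit Types u y z : infmx R.

Definition infmx1 : infmx R := fun p => (p.1 == p.2)%:R.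

(* The sum over all k is the library's finitely supported one, whose value is 0
   if infinitely many terms are nonzero.  In the products used below the rows of
   the left factor or the columns of the right factor are finite. *)
Definition mul_infmx y z : infmx R :=
  fun p => \sum_(k \in [set: nat]) (y (p.1, k) * z (k, p.2)).

Definition adj_infmx u : infmx R := fun p => Num.conj (u (p.2, p.1) : R[i]).

Definition corner n z : 'M[R[i]]_n := \matrix_(i, j) z (val i, val j).

Definition Uinf : set (infmx R) :=
  [set u | exists n0 : nat,
    [/\ corner n0 u \is unitarymx,
        forall i, (n0 <= i)%N -> u (i, i) = 1 &
        forall i j, i != j -> (n0 <= maxn i j)%N -> u (i, j) = 0]].

Lemma Uinf_adj u : Uinf u -> Uinf (adj_infmx u).
Proof.
move=> [n [uU u1 u0]]; exists n; split.
- rewrite (_ : corner n _ = map_mx Num.conj (corner n u)^T) ?trmxC_unitary//.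
  by apply/matrixP => i j; rewrite !mxE.
- by move=> i ni; rewrite /adj_infmx u1// conjC1.
- by move=> i j ij nij; rewrite /adj_infmx u0 ?conjC0// 1?eq_sym 1?maxnC.
Qed.

Lemma adj_infmxK : involutive adj_infmx.
Proof. by move=> u; apply/funext => -[i j]; rewrite /adj_infmx /= conjCK. Qed.

Lemma mul_infmx_adj u : Uinf u -> mul_infmx u (adj_infmx u) = infmx1.
Proof.
have sum1 (f : nat -> R[i]) i : (forall k, k != i -> f k = 0) ->
    \sum_(k \in [set: nat]) f k = f i.
  move=> f0; rewrite (fsbigE [:: i])//= ?big_cons ?big_nil ?in_setT ?addr0//.
  by move=> k _; rewrite inE; exact: f0.
move=> [n [/unitarymxP uU u1 u0]]; apply/funext => -[i j].
rewrite /mul_infmx /adj_infmx /infmx1 /=.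
have [ni|ilt] := leqP n i.
  rewrite (sum1 _ i) => [|k ki]; last first.
    by rewrite u0 ?mul0r// 1?eq_sym// leq_max ni.
  rewrite u1// mul1r; case: eqVneq => [<-|ij]; first by rewrite u1// conjC1.
  by rewrite u0 ?conjC0// 1?eq_sym// leq_max ni orbT.
have [nj|jlt] := leqP n j.
  rewrite (sum1 _ j) => [|k kj]; last first.
    by rewrite [u (j, k)]u0 ?conjC0 ?mulr0// 1?eq_sym// leq_max nj.
  have ij : i != j by rewrite neq_ltn (leq_trans ilt nj).
  by rewrite u0 ?mul0r ?(negPf ij)// leq_max nj orbT.
have /matrixP/(_ (Ordinal ilt) (Ordinal jlt)) := uU.
rewrite !mxE -val_eqE /= => <-.
rewrite (fsbigE (index_iota 0 n)) ?iota_uniq//=; last first.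
  move=> k _; rewrite mem_index_iota /= -leqNgt => nk.
  by rewrite u0 ?mul0r ?leq_max ?nk ?orbT// neq_ltn (leq_trans ilt nk).
rewrite (eq_bigl xpredT) => [|k]; last by rewrite in_setT.
by rewrite big_mkord; apply: eq_bigr => k _; rewrite !mxE.
Qed.

Lemma adj_mul_infmx u : Uinf u -> mul_infmx (adj_infmx u) u = infmx1.
Proof. by move=> /Uinf_adj/mul_infmx_adj; rewrite adj_infmxK. Qed.

(* u1 z u2^-1, the inverse of a unitary matrix being its adjoint: see
   mul_infmx_adj and adj_mul_infmx. *)
Definition act u1 u2 z : infmx R := mul_infmx (mul_infmx u1 z) (adj_infmx u2).

Definition invariant_set (A : set (borel_infmx R)) :=
  forall u1 u2, Uinf u1 -> Uinf u2 -> act u1 u2 @^-1` A = A.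

Definition invariant_measure (nu : {measure set (borel_infmx R) -> \bar R}) :=
  forall u1 u2, Uinf u1 -> Uinf u2 ->
  forall A : set (borel_infmx R), measurable A ->
  nu (act u1 u2 @^-1` A) = nu A.

Definition ergodic (nu : {measure set (borel_infmx R) -> \bar R}) :=
  forall A : set (borel_infmx R),
  measurable A -> invariant_set A ->
  nu A = 0%E \/ nu (~` A) = 0%E.

Definition max_modulus m z : R :=
  \big[Num.max/0]_(i < m) \big[Num.max/0]_(j < m) Normc.normc (z (val i, val j)).

Definition classF m (nu : {measure set (borel_infmx R) -> \bar R}) :=
  forall r : R, 0 < r ->
  (nu [set z : borel_infmx R | (max_modulus m z < r)%R] < +oo)%E.

End infinite_unitary_group.

(* Main.v *)
Require Import Defs.
From mathcomp Require Import all_boot all_order all_algebra complex.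
From mathcomp Require Import all_classical all_reals all_analysis.
From mathcomp Require Import measurable_realfun ring lra zify.

(* Fix r > 0 and let B_j be the event that the j-th m x m diagonal block of z
   has all its entries of modulus < r.  Simultaneous permutations of rows and
   columns lie in the group, so nu (B_j) = b < +oo and nu (B_i `&` B_j) = c do
   not depend on i <> j.  Hence the averages f_k of the indicators of the B_j
   over the windows N <= j < 2N, N = 8^(k + L), form a fast Cauchy sequence in L^2(nu), with
   squared norms at least c.  If c > 0, then for suitable t_k decreasing to
   t > 0 the set F = liminf {f_k > t_k} has positive finite measure, and F is
   exactly invariant, because an element of the group fixes all the entries
   z_ij with i and j large.  By ergodicity the complement of F is null, so nu is
   finite.  If c = 0 for all r, then nu = 0, because the sets B_0 `&` B_1 exhaust
   the space as r grows. *)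

Set Implicit Arguments.
Unset Strict Implicit.
Unset Printing Implicit Defensive.

Import Order.TTheory GRing.Theory Num.Theory.
Import numFieldNormedType.Exports.

Local Open Scope classical_set_scope.
Local Open Scope ring_scope.

(** * Second moments of combinations of indicators, and Chebyshev bounds *)

Section exchangeable_events.
Context d (T : measurableType d) (R : realType).
Variables (mu : {measure set T -> \bar R}) (B : nat -> set T) (b c : R).
Hypothesis mB : forall j, measurable (B j).
Hypothesis muB : forall j, mu (B j) = b%:E.
Hypothesis muBB : forall i j, i <> j -> mu (B i `&` B j) = c%:E.

Definition comb (s : seq nat) (a : nat -> R) (x : T) : R :=
  \sum_(j <- s) a j * \1_(B j) x.

Lemma measurable_comb s a : measurable_fun setT (comb s a).
Proof. by apply: measurable_sum => j; apply: measurable_funM. Qed.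

Lemma measurable_superlevel (f : T -> R) (t : R) :
  measurable_fun setT f -> measurable [set x | t < f x].
Proof.
move=> mf; rewrite [X in measurable X](_ : _ = setT `&` f @^-1` `]t, +oo[%classic).
  exact: mf.
by rewrite setTI; apply/seteqP; split=> x /=; rewrite in_itv/= andbT.
Qed.

Lemma integral_sum_indic (I : Type) (s : seq I) (a e : I -> R) (A : I -> set T) :
  (forall i, measurable (A i)) -> (forall i, mu (A i) = (e i)%:E) ->
  (\int[mu]_x (\sum_(i <- s) a i * \1_(A i) x)%:E =
   (\sum_(i <- s) a i * e i)%:E)%E.
Proof.
move=> mA muA.
have intA i : mu.-integrable setT (fun x => (\1_(A i) x)%:E).
  apply/integrableP; split; first exact/measurable_EFinP.
  under eq_integral do rewrite gee0_abs ?lee_fin//.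
  by rewrite integral_indic// setIT muA ltry.
under eq_integral do rewrite -sumEFin; rewrite -sumEFin.
rewrite integral_sum//=.
  apply: eq_bigr => i _; rewrite EFinM -muA.
  under eq_integral do rewrite EFinM.
  by rewrite integralZl// integral_indic// setIT.
by move=> i; under eq_fun do rewrite EFinM; exact: integrableZl.
Qed.

Lemma integral_comb s a :
  (\int[mu]_x (comb s a x)%:E = ((\sum_(j <- s) a j) * b)%:E)%E.
Proof. by rewrite (integral_sum_indic _ _ (e := fun=> b))// mulr_suml. Qed.

(** The square expands over pairs of indices; diagonal pairs weigh [b] and the others [c]. Writing
    [b] as [c + (b - c)] completes the square of the sum. Uniqueness of [s] makes the diagonal
    appear exactly once per index. *)
Lemma integral_comb_sqr s a : uniq s ->
  (\int[mu]_x (comb s a x ^+ 2)%:E =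
   (c * (\sum_(j <- s) a j) ^+ 2 + (b - c) * \sum_(j <- s) a j ^+ 2)%:E)%E.
Proof.
move=> us.
pose e (p : nat * nat) := if p.1 == p.2 then b else c.
pose q := [seq (i, j) | i <- s, j <- s].
have -> : (fun x => (comb s a x ^+ 2)%:E) =
    fun x => (\sum_(p <- q) (a p.1 * a p.2) * \1_(B p.1 `&` B p.2) x)%:E.
  apply/funext => x; congr EFin; rewrite big_allpairs /= expr2 /comb mulr_suml.
  apply: eq_bigr => i _; rewrite mulr_sumr; apply: eq_bigr => j _.
  by rewrite indicI /=; ring.
rewrite (integral_sum_indic _ _ (e := e)); last 2 first.
- by move=> p; exact: measurableI.
- move=> [i j] /=; rewrite /e/=; case: eqVneq => [->|/eqP ij].
    by rewrite setIid muB.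
  by rewrite muBB.
congr EFin; rewrite big_allpairs /=.
transitivity (\sum_(i <- s) (c * (a i * \sum_(j <- s) a j) + (b - c) * a i ^+ 2)).
  apply: eq_big_seq => i si.
  transitivity (\sum_(j <- s) (c * (a i * a j) +
      (if j == i then (b - c) * (a i * a j) else 0))).
    apply: eq_bigr => j _; rewrite /e/= [j == i]eq_sym.
    by case: ifP => _; ring.
  rewrite big_split/= -!mulr_sumr; congr (_ + _).
  rewrite (bigD1_seq i)//= eqxx big1 ?addr0 ?expr2// => j /negPf ->.
  by [].
by rewrite big_split/= -mulr_sumr -mulr_suml -mulr_sumr expr2.
Qed.

Lemma chebyshev_comb s a (t : R) : uniq s -> 0 < t ->
  ((t ^+ 2)%:E * mu [set x | (t < comb s a x)%R] <=
   (c * (\sum_(j <- s) a j) ^+ 2 + (b - c) * \sum_(j <- s) a j ^+ 2)%:E)%E.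
Proof.
move=> us t0; rewrite -(integral_comb_sqr _ us).
set S := [set x | _].
have mS : measurable S by exact/measurable_superlevel/measurable_comb.
have -> : ((t ^+ 2)%:E * mu S = \int[mu]_x (t ^+ 2 * \1_S x)%:E)%E.
  under eq_integral do rewrite EFinM.
  rewrite ge0_integralZl_EFin ?sqr_ge0//; last exact/measurable_EFinP.
  by rewrite integral_indic// setIT.
apply: ge0_le_integral => //.
- by move=> x _; rewrite lee_fin mulr_ge0// sqr_ge0.
- by apply/measurable_EFinP; apply: measurable_funM.
- apply/measurable_EFinP; exact/measurable_funX/measurable_comb.
- move=> x _; rewrite lee_fin indicE; case: (boolP (x \in S)) => [|_].
    by rewrite inE /S/= => tx; rewrite mulr1 !expr2; nra.
  by rewrite mulr0 sqr_ge0.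
Qed.

(** As [s] and [s'] are disjoint, the difference is a single combination over [s ++ s'] with the
    coefficients negated on [s'], so [chebyshev_comb] applies. *)
Lemma chebyshev_comb_sub s s' a a' (t : R) :
  uniq s -> uniq s' -> ~~ has (mem s) s' -> 0 < t ->
  ((t ^+ 2)%:E * mu [set x | (t < comb s a x - comb s' a' x)%R] <=
   (c * (\sum_(j <- s) a j - \sum_(j <- s') a' j) ^+ 2 +
    (b - c) * (\sum_(j <- s) a j ^+ 2 + \sum_(j <- s') a' j ^+ 2))%:E)%E.
Proof.
move=> us us' ss' t0.
pose e j := if j \in s then a j else - a' j.
have sumE (I : zmodType) (F : R -> I) : \sum_(j <- s ++ s') F (e j) =
    \sum_(j <- s) F (a j) + \sum_(j <- s') F (- a' j).
  rewrite big_cat/=; congr (_ + _); apply: eq_big_seq => j.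
    by rewrite /e => ->.
  by move=> /(hasPn ss') /negPf; rewrite /e /= => ->.
rewrite [X in mu X](_ : _ = [set x | t < comb (s ++ s') e x]).
  apply: (le_trans (chebyshev_comb _ _ t0)); first by rewrite cat_uniq us ss'.
  rewrite (sumE _ id) (sumE _ (fun y => y ^+ 2)) sumrN.
  by under [\sum_(j <- s') (- _) ^+ 2]eq_bigr do rewrite sqrrN.
apply/funext => x/=; congr (is_true (_ < _)).
rewrite /comb [RHS]big_cat/= -sumrN; congr (_ + _); apply: eq_big_seq => j.
  by rewrite /e => ->.
by move=> /(hasPn ss') /negPf; rewrite /e /= => ->; rewrite mulNr.
Qed.

(** * Uniform averages over windows of indices *)

Definition window n := index_iota n n.*2.

Definition window_mean n := comb (window n) (fun=> n%:R^-1).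

Lemma sum_window n : (0 < n)%N -> \sum_(j <- window n) n%:R^-1 = 1 :> R.
Proof.
move=> n0; rewrite big_const_nat -addnn addnK iter_addr_0.
rewrite -[_^-1 *+ _]mulr_natr mulVf//.
by rewrite pnatr_eq0 -lt0n.
Qed.

Lemma sum_window_sqr n : (0 < n)%N ->
  \sum_(j <- window n) n%:R^-1 ^+ 2 = n%:R^-1 :> R.
Proof.
move=> n0; under eq_bigr do rewrite expr2.
by rewrite -mulr_sumr sum_window// mulr1.
Qed.

Lemma window_mean_ge0 n x : 0 <= window_mean n x.
Proof. by apply: sumr_ge0 => j _; rewrite mulr_ge0. Qed.

Lemma window_mean_le1 n x : (0 < n)%N -> window_mean n x <= 1.
Proof.
move=> n0; rewrite -(sum_window n0); apply: ler_sum => j _.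
by rewrite ler_piMr// indicE; case: (_ \in _).
Qed.

Lemma joint_le_marginal : c <= b.
Proof.
rewrite -lee_fin -(@muBB 0 1)// -(muB 0); apply: le_measure; rewrite ?inE//.
exact: measurableI.
Qed.

Lemma joint_ge0 : 0 <= c. Proof. by rewrite -lee_fin -(@muBB 0 1). Qed.

(** The second moment [c + (b - c) / n] is at most [b]. This bound is uniform in [n], which later
    keeps the tail set of finite measure. *)
Lemma window_mean_gt_le n t : (0 < n)%N -> 0 < t ->
  ((t ^+ 2)%:E * mu [set x | (t < window_mean n x)%R] <= b%:E)%E.
Proof.
move=> n0 t0; apply: (le_trans (chebyshev_comb _ _ t0)); first exact: iota_uniq.
rewrite lee_fin sum_window// sum_window_sqr// expr1n mulr1.
have cb : 0 <= b - c by rewrite subr_ge0 joint_le_marginal.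
have : n%:R^-1 <= 1 :> R by rewrite invf_le1 ?ltr0n// ler1n.
by move=> /(ler_wpM2l cb); lra.
Qed.

(** The two windows are disjoint and both means have total weight 1, so the term in [c] cancels and
    only the small diagonal term remains. *)
Lemma window_mean_sub_gt_le n p t : (0 < n)%N -> (n.*2 <= p)%N -> 0 < t ->
  ((t ^+ 2)%:E * mu [set x | (t < window_mean n x - window_mean p x)%R] <=
   ((b - c) * (n%:R^-1 + p%:R^-1))%:E)%E.
Proof.
move=> n0 np t0.
have dis : ~~ has (mem (window n)) (window p).
  by apply/hasPn => j; rewrite /= !mem_index_iota; lia.
have p0 : (0 < p)%N by lia.
apply: (le_trans (chebyshev_comb_sub _ _ _ _ dis t0)); rewrite ?iota_uniq//.
by rewrite !sum_window// !sum_window_sqr// subrr expr0n mulr0 add0r.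
Qed.

(* Integrate f ^ 2 <= 1_(f > t) + t f, which holds because 0 <= f <= 1. *)
Lemma window_mean_gt_ge n t : (0 < n)%N -> 0 < t ->
  (c%:E <= mu [set x | (t < window_mean n x)%R] + (t * b)%:E)%E.
Proof.
move=> n0 t0; set S := [set x | _].
have mS : measurable S by exact/measurable_superlevel/measurable_comb.
have mf : measurable_fun setT (window_mean n) by exact: measurable_comb.
have -> : (t * b)%:E = (\int[mu]_x (t * window_mean n x)%:E)%E.
  under eq_integral do rewrite EFinM.
  rewrite ge0_integralZl_EFin ?(ltW t0)//.
  - by rewrite integral_comb sum_window// mul1r.
  - by move=> x _; rewrite lee_fin window_mean_ge0.
  - exact/measurable_EFinP.
have -> : mu S = (\int[mu]_x (\1_S x)%:E)%E by rewrite integral_indic// setIT.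
rewrite -ge0_integralD//; last 3 first.
- exact/measurable_EFinP.
- by move=> x _; rewrite lee_fin mulr_ge0 ?window_mean_ge0// ltW.
- by apply/measurable_EFinP/measurable_funM.
apply: (@le_trans _ _ (\int[mu]_x (window_mean n x ^+ 2)%:E)%E).
  rewrite integral_comb_sqr ?iota_uniq// lee_fin sum_window// sum_window_sqr//.
  by rewrite expr1n mulr1 lerDl mulr_ge0 ?subr_ge0 ?joint_le_marginal.
apply: ge0_le_integral => //.
- by move=> x _; rewrite lee_fin sqr_ge0.
- exact/measurable_EFinP/measurable_funX.
- by apply: emeasurable_funD; apply/measurable_EFinP => //; exact: measurable_funM.
- move=> x _; rewrite -EFinD lee_fin indicE.
  have f0 := window_mean_ge0 n x; have f1 := window_mean_le1 x n0.
  case: (boolP (x \in S)) => [_|] /=.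
    by have := mulr_ge0 (ltW t0) f0; rewrite expr2; nra.
  by rewrite notin_setE /S/= => /negP; rewrite -leNgt => ft; rewrite expr2; nra.
Qed.

(** * Measures of lower limits and of intersections of sets *)

Lemma measurable_liminf_set (S : nat -> set T) :
  (forall k, measurable (S k)) ->
  measurable (\bigcup_n \bigcap_(k in [set k | (n <= k)%N]) S k).
Proof.
move=> mS; apply: bigcup_measurable => n _.
by apply: bigcap_measurable => //; exists n => /=.
Qed.

Lemma measure_liminf_set_le (S : nat -> set T) (M : \bar R) :
  (forall k, measurable (S k)) -> (forall k, mu (S k) <= M)%E ->
  (mu (\bigcup_n \bigcap_(k in [set k | (n <= k)%N]) S k) <= M)%E.
Proof.
move=> mS SM; set F := fun n => \bigcap_(k in [set k | (n <= k)%N]) S k.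
have mF n : measurable (F n).
  by apply: bigcap_measurable => //; exists n => /=.
have ndF : nondecreasing_seq F.
  move=> n p np; apply/subsetPset => x Fx k /= pk.
  exact: Fx (leq_trans np pk).
have cF := nondecreasing_cvg_mu (mu := mu) mF (measurable_liminf_set mS) ndF.
rewrite -(cvg_lim _ cF)//; apply: lime_le; first exact: cvgP cF.
apply: nearW => n; apply: le_trans (SM n); apply: le_measure; rewrite ?inE//.
by move=> x; apply => /=.
Qed.

(** A point of [S 0] that misses the intersection must leave at some step, hence lies in some
    [S k]\[S k.+1]; the measures of these sets add up to at most [eps]. *)
Lemma measure_le_bigcap (S : nat -> set T) (eps : R) : 0 <= eps ->
  (forall k, measurable (S k)) ->
  (forall k, mu (S k `\` S k.+1) <= (eps / (2 ^ k.+1)%:R)%:E)%E ->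
  (mu (S 0%N) <= mu (\bigcap_k S k) + eps%:E)%E.
Proof.
move=> eps0 mS Seps; set G := \bigcap_k S k; set D := \bigcup_k (S k `\` S k.+1).
have mD k : measurable (S k `\` S k.+1) by exact: measurableD.
have mG : measurable G by exact: bigcap_measurable.
have mDD : measurable D by exact: bigcup_measurable.
apply: (@le_trans _ _ (mu (G `|` D))).
  apply: le_measure; rewrite ?inE//; first exact: measurableU.
  move=> x S0; have [|nD] := pselect (D x); [by right|left].
  elim=> [|k IH] // _; apply: contrapT => nS; apply: nD.
  by exists k => //; split=> //; exact: IH.
apply: (le_trans (measureU2 _ mG mDD)) => //; apply: leeD2l.
apply: (le_trans (generalized_Boole_inequality _ mD mDD)).
apply: le_trans (epsilon_trick0 xpredT eps0).
by apply: lee_nneseries => // k _; exact: Seps.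
Qed.

(** The map [phi] stands for a group element, which preserves all but finitely many of the events. A
    lower limit ignores finitely many terms, so its invariance is an equality of sets and not merely
    one up to null sets. *)
Lemma exists_tail_set : 0 < c -> exists F : set T,
  [/\ measurable F, (0 < mu F)%E, (mu F < +oo)%E &
      forall n phi, (forall j, (n <= j)%N -> phi @^-1` B j = B j) ->
      phi @^-1` F = F].
Proof.
move=> c0; have b0 : 0 < b := lt_le_trans c0 joint_le_marginal.
(* The first threshold will be [2 * t], so that [thr 0 * b = c / 2]: at least [c / 2] of measure
   lies in [S 0], of which at most [c / 4] is lost afterwards. *)
pose t := c / (4 * b).
have t0 : 0 < t by rewrite divr_gt0// mulr_gt0.
(* [64 * b / (t ^+ 2 * c)] is the constant left over when the Chebyshev bound for [S_sub] is
   compared with [c / 4 / 2 ^ k.+1]. The factor [8 ^ k] in the window size beats the [4 ^ k] from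
   the squared gap and leaves a summable [2 ^ -k]. *)
have [L hL] : exists L, 64 * b / (t ^+ 2 * c) <= (8 ^ L)%:R.
  have q0 : 0 <= 64 * b / (t ^+ 2 * c).
    by rewrite ltW// divr_gt0// mulr_gt0// exprn_gt0.
  exists (Num.bound (64 * b / (t ^+ 2 * c))).
  apply: (le_trans (ltW (archi_boundP q0))).
  by rewrite ler_nat ltnW// ltn_expl.
pose N k := (8 ^ (k + L))%N.
have N0 k : (0 < N k)%N by rewrite expn_gt0.
(* The [k]-th window starts at [N k], so from [k = n] on it only involves events of index at least
   [n]. *)
have kN k : (k <= N k)%N.
  exact: leq_trans (leq_addr L k) (ltnW (ltn_expl (k + L) (isT : (1 < 8)%N))).
pose thr k : R := t + t / (2 ^ k)%:R.
have thr_gt k : t < thr k.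
  by rewrite ltrDl divr_gt0// ltr0n expn_gt0.
pose S k := [set x | thr k < window_mean (N k) x].
have mS k : measurable (S k) by exact/measurable_superlevel/measurable_comb.
have S_le k : (mu (S k) <= (b / t ^+ 2)%:E)%E.
  have := window_mean_gt_le (N0 k) t0.
  rewrite -lee_pdivlMl ?exprn_gt0// -EFinM mulrC; apply: le_trans.
  apply: le_measure; rewrite ?inE//.
    exact/measurable_superlevel/measurable_comb.
  by move=> x /=; exact: lt_trans.
(* Lowering the thresholds puts S k `\` S k.+1 in a set where two consecutive
   means differ by at least t / 2 ^ k.+1, to which Chebyshev applies. *)
have S_sub k : (mu (S k `\` S k.+1) <= (c / 4 / (2 ^ k.+1)%:R)%:E)%E.
  pose e := t / (2 ^ k.+1)%:R.
  have e0 : 0 < e by rewrite divr_gt0// ltr0n expn_gt0.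
  have NN : ((N k).*2 <= N k.+1)%N by rewrite /N addSn expnS; lia.
  have := window_mean_sub_gt_le (N0 k) NN e0.
  rewrite -lee_pdivlMl ?exprn_gt0// => /(le_trans _) /le_trans; apply.
    apply: le_measure; rewrite ?inE//; first exact: measurableD.
      by apply/measurable_superlevel/measurable_funB; exact: measurable_comb.
    move=> x [/= Sk /negP]; rewrite -leNgt => Sk1.
    have thrE : thr k - thr k.+1 = e.
      rewrite /thr /e expnS natrM; field.
      by rewrite pnatr_eq0 expn_eq0.
    rewrite /= -thrE; apply: (ltr_leD Sk); rewrite lerN2. exact Sk1.
  rewrite -EFinM lee_fin; set p : R := (2 ^ k)%:R; set M : R := (8 ^ L)%:R.
  have p0 : 0 < p by rewrite ltr0n expn_gt0.
  have M0 : 0 < M by rewrite ltr0n expn_gt0.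
  have NE : (N k)%:R = p ^+ 3 * M.
    by rewrite /N expnD natrM /p -natrX -expnM mulnC expnM.
  (* Weaken [b - c] to [b] and the inverse of [N k.+1] to that of [N k]. *)
  apply: (@le_trans _ _ (e ^- 2 * (b * (2 / (N k)%:R)))).
    apply: ler_wpM2l; first by rewrite invr_ge0 sqr_ge0.
    apply: ler_pM; rewrite ?subr_ge0 ?joint_le_marginal ?addr_ge0 ?invr_ge0//.
      by rewrite gerBl joint_ge0.
    rewrite mulrDl mul1r lerD2l lef_pV2 ?posrE ?ltr0n// ler_nat.
    by apply: leq_trans NN; rewrite -addnn leq_addr.
  have -> : e ^- 2 * (b * (2 / (N k)%:R)) =
      64 * b / (t ^+ 2 * c) / M * (c / 4 / (2 ^ k.+1)%:R).
    rewrite NE /e expnS natrM -/p; field.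
    by rewrite !gt_eqF.
  rewrite ler_piMl ?divr_ge0 ?(ltW c0)//.
  by rewrite ler_pdivrMr// mul1r.
have thr0 : thr 0%N * b = c / 2.
  rewrite /thr /t expn0; field.
  by rewrite gt_eqF.
clearbody N thr.
pose F := \bigcup_n \bigcap_(k in [set k | (n <= k)%N]) S k.
have mF : measurable F by exact: measurable_liminf_set.
exists F; split=> //.
- have c40 : 0 <= c / 4 by rewrite divr_ge0// ltW.
  have mG : measurable (\bigcap_k S k) by exact: bigcap_measurable.
  have GF : \bigcap_k S k `<=` F by move=> x Gx; exists 0%N => // k _; exact: Gx.
  have : (mu (\bigcap_k S k) <= mu F)%E by apply: le_measure; rewrite ?inE.
  apply: lt_le_trans.
  (* If the intersection were null, this would give [c <= c / 4 + c / 2]. *)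
  have := window_mean_gt_ge (N0 0%N) (lt_trans t0 (thr_gt 0%N)).
  move=> /le_trans /(_ (leeD2r _ (measure_le_bigcap c40 mS S_sub))).
  rewrite thr0 lt_neqAle measure_ge0 andbT => le_c; apply/eqP => G0.
  by move: le_c; rewrite -G0 add0e -EFinD lee_fin; lra.
- by apply: le_lt_trans (ltry (b / t ^+ 2)); exact: measure_liminf_set_le.
- move=> n phi phiB.
  have phiS k x : (n <= k)%N -> S k (phi x) = S k x.
    move=> nk; rewrite /S/=; congr (is_true (_ < _)).
    apply: eq_big_seq => j; rewrite mem_index_iota => /andP[Nj _].
    congr (_ * _); rewrite !indicE; congr (nat_of_bool _)%:R.
    have nj : (n <= j)%N.
      exact: leq_trans (leq_trans nk (kN k)) Nj.
    by rewrite -[in RHS](phiB j nj); apply/idP/idP; rewrite !inE.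
  apply/seteqP; split=> x [p _ Fp]; exists (maxn n p) => // k /=.
    rewrite geq_max => /andP[nk pk]; rewrite -phiS//; exact: Fp.
  rewrite geq_max => /andP[nk pk]; rewrite phiS//; exact: Fp.
Qed.

End exchangeable_events.

Lemma measure_conull_lty d (T : measurableType d) (R : realType)
  (mu : {measure set T -> \bar R}) (F : set T) :
  measurable F -> mu (~` F) = 0%E -> (mu F < +oo)%E -> (mu [set: T] < +oo)%E.
Proof.
move=> mF nF0 Foo; rewrite -(setUv F).
apply: le_lt_trans (measureU2 _ mF (measurableC mF)) _.
by rewrite [X in (_ + X)%E]nF0 adde0.
Qed.

(** * The action far from the corner, and by permutation matrices *)

Section blocks.
Variable R : realType.
Local Open Scope complex_scope.
Implicit Types (y z u : infmx R) (p : nat -> nat).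

Lemma fsbig_support1 (f : nat -> R[i]) i : (forall k, k != i -> f k = 0) ->
  \sum_(k \in [set: nat]) f k = f i.
Proof.
move=> f0; rewrite (fsbigE [:: i])//= ?big_cons ?big_nil ?in_setT ?addr0//.
by move=> k _; rewrite inE; exact: f0.
Qed.

(** Far out, the rows of [u1] and of [u2] are those of the identity, so each sum has a single
    nonzero term. *)
Lemma act_tail u1 u2 : Uinf u1 -> Uinf u2 -> exists n, forall z i j,
  (n <= i)%N -> (n <= j)%N -> act u1 u2 z (i, j) = z (i, j).
Proof.
move=> [n1 [_ d1 o1]] [n2 [_ d2 o2]]; exists (maxn n1 n2) => z i j.
rewrite !geq_max => /andP[i1 _] /andP[_ j2].
rewrite /act /mul_infmx /adj_infmx /= (@fsbig_support1 _ j) => [|k kj].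
  rewrite d2// conjC1 mulr1 (@fsbig_support1 _ i) => [|k ki].
    by rewrite d1// mul1r.
  by rewrite o1 ?mul0r// 1?eq_sym// leq_max i1.
by rewrite [u2 _]o2 ?conjC0 ?mulr0// 1?eq_sym// leq_max j2.
Qed.

Definition perm_infmx p : infmx R := fun q => (q.1 == p q.2)%:R.

Lemma act_perm_infmx p z i j : involutive p ->
  act (perm_infmx p) (perm_infmx p) z (i, j) = z (p i, p j).
Proof.
move=> pK; rewrite /act /mul_infmx /adj_infmx /perm_infmx /=.
rewrite (@fsbig_support1 _ (p j)) => [|k kj].
  rewrite pK eqxx conjC1 mulr1 (@fsbig_support1 _ (p i)) => [|k ki].
    by rewrite pK eqxx mul1r.
  by rewrite -{1}(pK i) (inj_eq (inv_inj pK)) eq_sym (negPf ki) mul0r.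
by rewrite -{1}(pK j) (inj_eq (inv_inj pK)) eq_sym (negPf kj) conjC0 mulr0.
Qed.

Lemma Uinf_perm_infmx p n : involutive p -> (forall i, (n <= i)%N -> p i = i) ->
  Uinf (perm_infmx p).
Proof.
move=> pK pn; have p_lt i : (i < n)%N -> (p i < n)%N.
  by apply: contraTT; rewrite -!leqNgt => npi; rewrite -(pK i) pn.
exists n; split=> [|i ni|i j ij].
- apply/unitarymxP/matrixP => i j; rewrite !mxE.
  rewrite (bigD1 (Ordinal (p_lt _ (ltn_ord i))))//= big1 => [|k ki].
    rewrite !mxE /perm_infmx /= !pK eqxx mul1r addr0 eq_sym.
    by rewrite -val_eqE/= -[RHS]conjC_nat.
  rewrite !mxE /perm_infmx /= -{1}(pK (val i)) (inj_eq (inv_inj pK)) eq_sym.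
  by move: ki; rewrite -val_eqE/= => /negPf ->; rewrite mul0r.
- by rewrite /perm_infmx/= pn// eqxx.
- rewrite /perm_infmx/= leq_max => /orP[ni|nj].
    by rewrite -(pn i)// (inj_eq (inv_inj pK)) (negPf ij).
  by rewrite pn// (negPf ij).
Qed.

(** * Diagonal blocks and their swaps *)

Definition swap (a b k : nat) := if k == a then b else if k == b then a else k.

Lemma swapK a b : involutive (swap a b).
Proof.
move=> k; rewrite /swap.
case: (eqVneq k a) => [->|ka]; first by rewrite eqxx; case: eqVneq.
case: (eqVneq k b) => [->|kb]; first by rewrite eqxx.
by rewrite (negPf ka) (negPf kb).
Qed.

Lemma swapL a b : swap a b a = b. Proof. by rewrite /swap eqxx. Qed.

Lemma swapR a b : swap a b b = a.
Proof. exact: canLR (swapK a b) (esym (swapL a b)). Qed.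

Lemma swapD a b k : k != a -> k != b -> swap a b k = k.
Proof. by rewrite /swap => /negPf -> /negPf ->. Qed.

Definition block_swap m a b i := (swap a b (i %/ m) * m + i %% m)%N.

Lemma block_swapE m a b j i : (i < m)%N ->
  block_swap m a b (j * m + i) = (swap a b j * m + i)%N.
Proof.
move=> im; have m0 : (0 < m)%N by exact: leq_ltn_trans im.
by rewrite /block_swap divnMDl// divn_small// addn0 modnMDl modn_small.
Qed.

Lemma block_swapK m a b : (0 < m)%N -> involutive (block_swap m a b).
Proof.
move=> m0 i; rewrite {2}/block_swap block_swapE ?ltn_mod// swapK.
by rewrite -divn_eq.
Qed.

Lemma Uinf_block_swap m a b : (0 < m)%N -> Uinf (perm_infmx (block_swap m a b)).
Proof.
(* From this index on, the block number [i %/ m] exceeds both [a] and [b]. *)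
move=> m0; apply: (@Uinf_perm_infmx _ ((maxn a b).+1 * m)).
  exact: block_swapK.
move=> i; rewrite -leq_divRL// gtn_max => /andP[ai bi].
by rewrite /block_swap swapD ?gtn_eqF// -divn_eq.
Qed.

Definition block m j z : infmx R := fun q => z (j * m + q.1, j * m + q.2)%N.

Definition small_block m (r : R) j : set (borel_infmx R) :=
  [set z | max_modulus m (block m j z) < r].

Lemma eq_max_modulus m y z :
  (forall i j, (i < m)%N -> (j < m)%N -> y (i, j) = z (i, j)) ->
  max_modulus m y = max_modulus m z.
Proof.
by move=> yz; apply: eq_bigr => i _; apply: eq_bigr => j _; rewrite yz ?ltn_ord.
Qed.

Lemma measurable_small_block m r j : measurable (small_block m r j).
Proof.
(* The maxima start from the value 0, so the set is empty for [r <= 0]; for [r > 0] it is a finite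
   intersection of open cylinders. *)
have [r0|r0] := leP r 0.
  rewrite (_ : small_block m r j = set0)//; apply/seteqP; split=> z //=.
  rewrite /small_block/= => /lt_le_trans/(_ r0); apply/negP; rewrite -leNgt.
  by apply: bigmax_ge_id.
have -> : small_block m r j = \bigcap_(i in [set: 'I_m])
    \bigcap_(l in [set: 'I_m])
      [set z : infmx R | Normc.normc (z (j * m + i, j * m + l)%N) < r].
  apply/seteqP; split=> z /=.
    move=> /bigmax_ltP[_ zi] i _ l _; have /bigmax_ltP[_] := zi i isT.
    exact.
  move=> zil; apply/bigmax_ltP; split=> // i _.
  by apply/bigmax_ltP; split=> // l _; exact: zil.
apply: fin_bigcap_measurable => // i _; apply: fin_bigcap_measurable => // l _.
apply: sub_sigma_algebra.
set q := (_, _).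
have -> : [set z : infmx R | Normc.normc (z q) < r] =
    proj q @^-1` ball (0 : R[i]^o) r%:C.
  have normE (w : R[i]) : `|w| = (Normc.normc w)%:C.
    by case: w => x y; rewrite normc_def.
  by apply/funext => z; rewrite /= /ball/= sub0r normrN normE ltcR.
apply: open_comp; last exact: ball_open.
by move=> z _; exact: proj_continuous.
Qed.

Lemma act_small_block_swap m r a b j : (0 < m)%N ->
  let u := perm_infmx (block_swap m a b) in
  act u u @^-1` small_block m r j = small_block m r (swap a b j).
Proof.
move=> m0 u; apply/funext => z; rewrite /small_block/=; congr (is_true (_ < _)).
apply: eq_max_modulus => i l im lm.
by rewrite /block /= act_perm_infmx ?block_swapE//; exact: block_swapK.
Qed.

Lemma small_block_tail m r u1 u2 : (0 < m)%N -> Uinf u1 -> Uinf u2 ->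
  exists n, forall j, (n <= j)%N ->
  act u1 u2 @^-1` small_block m r j = small_block m r j.
Proof.
move=> m0 U1 U2; have [n un] := act_tail U1 U2; exists n => j nj.
apply/funext => z; rewrite /small_block/=; congr (is_true (_ < _)).
have njm : (n <= j * m)%N by rewrite (leq_trans nj)// leq_pmulr.
apply: eq_max_modulus => i l _ _; rewrite /block /= un//.
  exact: leq_trans njm (leq_addr _ _).
exact: leq_trans njm (leq_addr _ _).
Qed.

End blocks.

(** * Exchangeability of the blocks, and finiteness by ergodicity *)

Theorem theorem1 (R : realType) (m : nat) (m_gt0 : (0 < m)%N)
    (nu : {measure set (borel_infmx R) -> \bar R})
    (nu_classF : classF m nu) (nu_inv : invariant_measure nu)
    (nu_ergodic : ergodic nu) :
  (nu [set: borel_infmx R] < +oo)%E.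
Proof.
pose B (r : R) := small_block m r.
have mB r j : measurable (B r j) by exact: measurable_small_block.
have nuBB r a b i j :
    nu (B r (swap a b i) `&` B r (swap a b j)) = nu (B r i `&` B r j).
  have U := Uinf_block_swap R a b m_gt0.
  rewrite -(nu_inv _ _ U U (B r i `&` B r j)); last exact: measurableI.
  by rewrite preimage_setI !act_small_block_swap.
have nuB r j : nu (B r j) = nu (B r 0%N).
  by have := nuBB r 0%N j 0%N 0%N; rewrite swapL !setIid.
have nuB_fin r : 0 < r -> nu (B r 0%N) \is a fin_num.
  (* Block 0 is the corner itself, since [0 * m + i] reduces to [i]. *)
  by move=> r0; rewrite ge0_fin_numE//; exact: nu_classF.
have nuBne r i j : i <> j -> nu (B r i `&` B r j) = nu (B r 0%N `&` B r 1%N).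
  (* Swapping 0 with [i] turns the pair into [(0, l)] with [l != 0]; swapping 1 with [l] then fixes
     0 and yields [(0, 1)]. *)
  move=> /eqP ij; have := nuBB r 0%N i i j; rewrite swapR => <-.
  have : swap 0 i j != 0%N.
    by rewrite -[X in _ != X](swapR 0%N i) (inj_eq (inv_inj (swapK _ _))) eq_sym.
  move: (swap _ _ _) => l l0; have := nuBB r 1%N l 0%N l.
  by rewrite swapR swapD// eq_sym.
have nuBB_fin r : 0 < r -> nu (B r 0%N `&` B r 1%N) \is a fin_num.
  move=> r0; rewrite ge0_fin_numE//; apply: (@le_lt_trans _ _ (nu (B r 0%N))).
    by apply: le_measure; rewrite ?inE//; exact: measurableI.
  by rewrite -ge0_fin_numE// nuB_fin.
have [[r [r0 c0]]|B0] :=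
    pselect (exists r, 0 < r /\ (0 < nu (B r 0%N `&` B r 1%N))%E).
  have [|||F [mF F0 Foo FE]] := @exists_tail_set _ _ R nu (B r)
      (fine (nu (B r 0%N))) (fine (nu (B r 0%N `&` B r 1%N))) (mB r).
  - by move=> j; rewrite fineK ?nuB_fin.
  - by move=> i j ij; rewrite fineK ?nuBB_fin// nuBne.
  - by rewrite fine_gt0// c0 -ge0_fin_numE// nuBB_fin.
  have [F00|nF0] : nu F = 0%E \/ nu (~` F) = 0%E.
  - apply: nu_ergodic => // u1 u2 U1 U2.
    by have [n un] := small_block_tail r m_gt0 U1 U2; exact: FE un.
  - by rewrite F00 ltxx in F0.
  - exact: measure_conull_lty mF nF0 Foo.
(* The radius is [n.+1] because [B0] gives null sets only for positive radii. *)
have -> : [set: borel_infmx R] = \bigcup_n (B n.+1%:R 0%N `&` B n.+1%:R 1%N).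
  apply/seteqP; split=> // z _.
  set a := max_modulus m (block m 0 z); set b := max_modulus m (block m 1 z).
  have ab : 0 <= Num.max a b by rewrite le_max bigmax_ge_id.
  exists (Num.bound (Num.max a b)) => //.
  have := archi_boundP ab; set n := Num.bound _ => abn.
  have : Num.max a b < n.+1%:R by rewrite (lt_trans abn)// ltr_nat.
  by rewrite gt_max => /andP[].
apply: (@le_lt_trans _ _ 0%E) => //.
have mBB n : measurable (B n.+1%:R 0%N `&` B n.+1%:R 1%N) by exact: measurableI.
apply: (le_trans (generalized_Boole_inequality _ mBB _)).
  exact: bigcup_measurable.
rewrite eseries0// => n _ _; apply/eqP; rewrite eq_le measure_ge0 andbT leNgt.
by apply/negP => n0; apply: B0; exists n.+1%:R.
Qed.
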